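(* The following are equivalent for a real number $b$. (a) There exists a strongly connected finite quiver with spectral radius $b$. (b) There exists a (square) integer matrix with spectral radius $b$. (c) $b$ is a nonnegative algebraic integer and no (complex) root of its irreducible polynomial over $\mathbb{Q}$ is larger than $b$ in modulus. Moreover, the set of real numbers $b$ satisfying the equivalent conditions (a), (b) and (c) is closed under addition, multiplication, and passage to roots (i.e. if $b$ is in the set and $m\ge 1$ is an integer then $\sqrt[m]{b}$ is in the set). This set is therefore a dense subset of $\{0\}\cup[1,\infty)$.
   Context: A quiver is a directed graph (loops and multiple arrows allowed). A (nonempty) quiver is strongly connected if for each ordered pair of vertices there is a path (possibly of length $0$) from the first to the second. The spectral radius of a finite quiver is the spectral radius of an adjacency matrix of it (the matrix whose $(i,j)$ entry is the number of arrows from the $i$-th vertex to the $j$-th vertex). The irreducible polynomial of an algebraic number over $\mathbb{Q}$ is its monic minimal polynomial. *)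

(* Defs.v *)
From HB Require Import structures.
From mathcomp Require Import all_boot all_order all_algebra complex.
From mathcomp Require Import all_classical all_reals all_analysis.

Set Implicit Arguments.
Unset Strict Implicit.
Unset Printing Implicit Defensive.

Import Order.TTheory GRing.Theory Num.Theory.
Import numFieldNormedType.Exports.

Local Open Scope classical_set_scope.
Local Open Scope ring_scope.

Record finite_quiver := FiniteQuiver {
  vertex : finType;
  arrow : finType;
  source : arrow -> vertex;
  target : arrow -> vertex }.

Definition num_arrows (Q : finite_quiver) (x y : vertex Q) : nat :=
  #|[pred a : arrow Q | (source a == x) && (target a == y)]|.

(* The vertices are listed in the order of the enumeration of their finType;
   another order would give a matrix with the same spectral radius. *)
Definition adjacency_mx (Q : finite_quiver) : 'M[int]_#|vertex Q| :=
  \matrix_(i, j) (num_arrows (enum_val i) (enum_val j))%:Z.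

Definition adjacent (Q : finite_quiver) : rel (vertex Q) :=
  fun x y => [exists a : arrow Q, (source a == x) && (target a == y)].

Definition strongly_connected (Q : finite_quiver) : Prop :=
  (0 < #|vertex Q|)%N /\ forall x y : vertex Q, connect (@adjacent Q) x y.

(* The set of eigenvalues is finite, and nonempty as soon as 0 < n, so this
   supremum is a maximum; for n = 0 it is sup set0 = 0. *)
Definition spectral_radius (R : realType) (n : nat) (A : 'M[int]_n) : R :=
  sup [set ComplexField.Normc.normc z
      | z in [set z : R[i] | eigenvalue (map_mx intr A) z]].

Definition irreducible_polynomial_of (R : realType) (b : R) (p : {poly rat})
    : Prop :=
  [/\ p \is monic, root (map_poly ratr p) b &
      forall q : {poly rat}, q != 0 -> root (map_poly ratr q) b ->
        (size p <= size q)%N].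

Definition quiver_radius (R : realType) (b : R) : Prop :=
  exists2 Q : finite_quiver,
    strongly_connected Q & spectral_radius R (adjacency_mx Q) = b.

Definition integer_matrix_radius (R : realType) (b : R) : Prop :=
  exists n : nat, exists A : 'M[int]_n,
    (0 < n)%N /\ spectral_radius R A = b.

Definition dominant_algebraic_integer (R : realType) (b : R) : Prop :=
  [/\ 0 <= b, integralOver (intr : int -> R) b &
      exists2 p : {poly rat}, irreducible_polynomial_of b p &
        forall z : R[i], root (map_poly ratr p) z ->
          ComplexField.Normc.normc z <= b].

Definition radii (R : realType) : set R :=
  [set b | [/\ quiver_radius b, integer_matrix_radius b &
               dominant_algebraic_integer b]].

Arguments radii : clear implicits.

(* Main.v *)
Require Import Defs.
From HB Require Import structures.
From mathcomp Require Import all_boot all_order all_algebra complex.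
From mathcomp Require Import all_classical all_reals all_analysis.
From mathcomp Require Import separable qfpoly.
From mathcomp Require Import zify ring lra.

Set Implicit Arguments.
Unset Strict Implicit.
Unset Printing Implicit Defensive.

Import Order.TTheory GRing.Theory Num.Theory.
Import numFieldNormedType.Exports.

Local Open Scope ring_scope.

(* The three sets of radii all coincide with the set of Perron values: reals b
   with b v = a v for a square matrix a of natural numbers and a positive vector
   v.  Perron values are closed under sums and products (Kronecker products) and
   under m-th roots (cyclic inflation), and such a system restricted to a minimal
   set of reachable vertices is a strongly connected quiver of radius b.

   If la is an eigenvalue of largest modulus b of an integer matrix A, then
   b^2 = la * conj la is an eigenvalue of X |-> A^T X A, an integer linear map
   whose eigenvalues are products of two eigenvalues of A; so every conjugate z
   of b satisfies |z|^2 <= b^2.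

   Conversely let b > 0 dominate its conjugates.  A conjugate r has modulus b
   iff b^2 / r is a conjugate too; by Galois conjugation of b to a conjugate g
   of modulus b, the map r |-> g^2 / r preserves the conjugates of modulus b, so
   (g / b)^2 permutes them and is a root of unity.  Hence some power c = b^N
   strictly dominates its conjugates, and Lind's argument applies: among the u in
   Z[c] with |u(z)| <= u(c) <= T at every conjugate z, each c u is a sum of
   elements of the same finite set once T is large. *)

(** * Perron values and their closure properties *)

(** Connectivity is left out, so that the constructions below need not preserve it; positivity of
    [v] alone already makes [b] the spectral radius of [a]. An arbitrary finite index type lets
    product types index Kronecker products. *)
Definition perron_value (R : realFieldType) (b : R) : Prop :=
  exists (T : finType) (v : T -> R) (a : T -> T -> nat),
    [/\ (0 < #|T|)%N, forall x, 0 < v x &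
        forall x, b * v x = \sum_y (a x y)%:R * v y].

Section PerronValues.
Variable R : realFieldType.
Implicit Types b c : R.

Lemma perron_value_nat (n : nat) : perron_value (n%:R : R).
Proof.
exists unit, (fun=> 1), (fun _ _ => n); split=> //; first by rewrite card_unit.
by move=> x; rewrite (bigD1 tt) //= big1 ?addr0 // => -[].
Qed.

(** The matrix is the Kronecker sum, a (x) 1 + 1 (x) e, acting on v (x) w. *)
Lemma perron_valueD b c :
  perron_value b -> perron_value c -> perron_value (b + c).
Proof.
move=> [T [v [a [T0 v0 av]]]] [U [w [e [U0 w0 ew]]]].
exists (T * U)%type, (fun x => v x.1 * w x.2),
  (fun x y => a x.1 y.1 * (x.2 == y.2) + (x.1 == y.1) * e x.2 y.2)%N.
split; first by rewrite card_prod muln_gt0 T0.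
  by move=> x; rewrite mulr_gt0.
move=> [x x'] /=.
under eq_bigr do rewrite natrD mulrDl.
rewrite big_split /=.
rewrite -(pair_bigA _ (fun y y' => (a x y * (x' == y'))%:R * (v y * w y'))) /=.
rewrite -(pair_bigA _ (fun y y' => ((x == y) * e x' y')%:R * (v y * w y'))) /=.
rewrite mulrDl mulrA av mulr_suml; congr (_ + _).
  apply: eq_bigr => y _; rewrite (bigD1 x') //= eqxx muln1 big1 ?addr0 ?mulrA //.
  by move=> y' /negPf; rewrite eq_sym => ->; rewrite muln0 mul0r.
rewrite (bigD1 x) //= [X in _ + X]big1 ?addr0; last first.
  move=> y /negPf; rewrite eq_sym => yx.
  by rewrite big1 // => y' _; rewrite yx mul0n mul0r.
rewrite mulrCA ew mulr_sumr; apply: eq_bigr => y' _.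
by rewrite eqxx mul1n mulrCA.
Qed.

Lemma perron_valueM b c :
  perron_value b -> perron_value c -> perron_value (b * c).
Proof.
move=> [T [v [a [T0 v0 av]]]] [U [w [e [U0 w0 ew]]]].
exists (T * U)%type, (fun x => v x.1 * w x.2),
  (fun x y => a x.1 y.1 * e x.2 y.2)%N.
split; first by rewrite card_prod muln_gt0 T0.
  by move=> x; rewrite mulr_gt0.
move=> [x x'] /=.
rewrite -(pair_bigA _ (fun y y' => (a x y * e x' y')%:R * (v y * w y'))) /=.
rewrite mulrACA av ew mulr_suml; apply: eq_bigr => y _.
rewrite mulr_sumr; apply: eq_bigr => y' _.
by rewrite natrM mulrACA.
Qed.

(** Take m + 1 layers, the i-th weighted by b^i: each vertex has one arrow to its copy in the next
    layer, and the last layer returns to the first through [a]. Positive weights require b > 0, so b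
    = 0 is treated apart. *)
Lemma perron_value_root b (m : nat) :
  0 <= b -> perron_value (b ^+ m.+1) -> perron_value b.
Proof.
rewrite le_eqVlt => /orP[/eqP <- _|b0]; first exact: (perron_value_nat 0).
move=> [T [v [a [T0 v0 av]]]].
exists (T * 'I_m.+1)%type, (fun x : T * 'I_m.+1 => v x.1 * b ^+ x.2),
  (fun x y => if x.2 == ord_max then (y.2 == ord0) * a x.1 y.1
              else (y == (x.1, inord x.2.+1)))%N.
split; first by rewrite card_prod muln_gt0 T0 card_ord.
  by move=> x; rewrite mulr_gt0 // exprn_gt0.
move=> [x i] /=; case: (eqVneq i ord_max) => [->|im].
  rewrite -(pair_bigA _ (fun y j => ((j == ord0) * a x y)%:R * (v y * b ^+ j))) /=.
  rewrite mulrCA -exprS mulrC av; apply: eq_bigr => y _.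
  rewrite (bigD1 ord0) //= mul1n expr0 mulr1 big1 ?addr0 //.
  by move=> j /negPf ->; rewrite mul0r.
rewrite (bigD1 (x, inord i.+1)) //= eqxx mul1r big1 ?addr0; last first.
  by move=> y /negPf ->; rewrite mul0r.
rewrite inordK; first by rewrite mulrCA exprS.
by rewrite ltnS ltn_neqAle -ltnS ltn_ord andbT.
Qed.

(** At a vertex x where v is minimal, either the row of x vanishes and b = 0, or it has an entry at
    some y and b v(x) >= v(y) >= v(x). *)
Lemma perron_value_eq0_or_ge1 b : perron_value b -> b = 0 \/ 1 <= b.
Proof.
move=> [T [v [a [/card_gt0P[x0 _] v0 av]]]].
have [x _ xmin] := @Order.TotalTheory.arg_minP _ _ T x0 xpredT v isT.
have [|/existsP[y ay]] := boolP [forall y, a x y == 0%N].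
  move=> /forallP ax; left; apply: (mulIf (lt0r_neq0 (v0 x))).
  by rewrite av mul0r big1 // => y _; rewrite (eqP (ax y)) mul0r.
right; rewrite -(ler_pM2r (v0 x)) mul1r av (bigD1 y) //=.
apply: (le_trans (xmin y isT)); rewrite -[leLHS]addr0 lerD //.
  by rewrite ler_peMl ?(ltW (v0 y)) // ler1n lt0n.
by apply: sumr_ge0 => z _; rewrite mulr_ge0 // ltW.
Qed.

Lemma perron_value_connect b : perron_value b ->
  exists (T : finType) (v : T -> R) (a : T -> T -> nat),
    [/\ (0 < #|T|)%N, forall x, 0 < v x,
        forall x, b * v x = \sum_y (a x y)%:R * v y &
        forall x y, connect (fun x y => 0 < a x y)%N x y].
Proof.
move=> [T [v [a [/card_gt0P[x0 _] v0 av]]]].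
pose e x y := (0 < a x y)%N.
(* A minimal set of reachable vertices is strongly connected and closed under arrows. *)
have [x _ xmin] := @arg_minnP T x0 xpredT (fun x => #|[set z | connect e x z]|) isT.
pose S := [pred y | connect e x y].
have eS y z : y \in S -> e y z -> z \in S.
  by move=> xy yz; apply: connect_trans (xy) (connect1 yz).
(* The set reachable from y in S lies inside S and, by minimality, is no smaller, so it is all of
   S. *)
have cS y z : y \in S -> z \in S -> connect e y z.
  move=> xy xz; have /subset_leqif_cards : [set z | connect e y z] \subset [set z | connect e x z].
    by apply/fintype.subsetP => t; rewrite !inE; apply: connect_trans.
  have le_xy := xmin y isT; move=> [le_yx].
  by rewrite eqn_leq le_xy le_yx => /esym/eqP/setP/(_ z); rewrite !inE [RHS]xz.
exists {y | y \in S}, (fun y => v (val y)), (fun y z => a (val y) (val z)).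
split=> //.
- by apply/card_gt0P; exists (exist _ x (connect0 e x)).
- move=> [y yS] /=; rewrite av (bigID (mem S)) /= [X in _ + X]big1 ?addr0.
    by rewrite big_sub.
  move=> z zS; case: (posnP (a y z)) => [->|yz]; first by rewrite mul0r.
  by rewrite (eS y z) in zS.
move=> [y yS] [z zS]; have /connectP[p yp zp] := cS _ _ yS zS.
elim: p y yS yp zp => [|t p IHp] y yS /= => [_ zy|/andP[yt tp] zp].
  by subst z; rewrite (bool_irrelevance zS yS) connect0.
apply: connect_trans (IHp t (eS _ _ yS yt) tp zp).
by apply: connect1.
Qed.

End PerronValues.

(** * The modulus of complex numbers, and eigenvalues of transposes *)

Section ComplexModulus.
Variable R : rcfType.
Implicit Types z : R[i].
Import ComplexField.Normc.

Lemma normc_ge0 z : 0 <= normc z.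
Proof. by case: z => x y; exact: sqrtr_ge0. Qed.

Lemma normc_eq0 z : (normc z == 0) = (z == 0).
Proof. by apply/eqP/eqP => [/eq0_normc//|->]; rewrite normc0. Qed.

Lemma normc_gt0 z : (0 < normc z) = (z != 0).
Proof. by rewrite lt0r normc_eq0 normc_ge0 andbT. Qed.

Lemma normcX z n : normc (z ^+ n) = normc z ^+ n.
Proof.
by elim: n => [|n IHn]; rewrite ?expr0 ?normc1 // !exprS normcM IHn.
Qed.

Lemma normc_realc (x : R) : normc (real_complex R x) = `|x|.
Proof. by rewrite /normc /= expr0n addr0 sqrtr_sqr. Qed.

Lemma normc_int (n : int) : normc (n%:~R : R[i]) = `|n%:~R|.
Proof. by rewrite -normc_realc rmorph_int. Qed.

Lemma mulcJ z : z * conjc z = real_complex R (normc z ^+ 2).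
Proof.
case: z => x y; rewrite /normc sqr_sqrtr ?addr_ge0 ?sqr_ge0 //.
by apply/eqP; rewrite eq_complex /= mulrN opprK !expr2 mulrN [y * x]mulrC addNr !eqxx.
Qed.

Lemma normcJc z : normc (conjc z) = normc z.
Proof. by case: z => x y; rewrite /normc /= sqrrN. Qed.

Lemma le_normc_sum (I : Type) (r : seq I) (P : pred I) (F : I -> R[i]) :
  normc (\sum_(i <- r | P i) F i) <= \sum_(i <- r | P i) normc (F i).
Proof.
elim/big_rec2: _ => [|i x y _ xy]; first by rewrite normc0.
by apply: le_trans (le_normcD _ _) _; rewrite lerD2l.
Qed.

End ComplexModulus.

Lemma char_poly_trmx (K : comNzRingType) n (A : 'M[K]_n) :
  char_poly A^T = char_poly A.
Proof.
by rewrite /char_poly -det_tr /char_poly_mx linearB /= tr_scalar_mx map_trmx trmxK.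
Qed.

Lemma eigenvalue_trmx (K : fieldType) n (A : 'M[K]_n) :
  eigenvalue A^T =1 eigenvalue A.
Proof. by move=> a; rewrite !eigenvalue_root_char char_poly_trmx. Qed.

(** * Perron values from finite sets closed under decomposition *)

Section PositiveCombinations.
Variables (R : realFieldType) (E : choiceType).

Lemma big_sub_count (s l : seq E) (v : E -> R) : {subset l <= s} ->
  \sum_(y <- l) v y =
  \sum_(y : seq_sub s) (count_mem (val y) l)%:R * v (val y).
Proof.
elim: l => [|a l IHl] als; first by rewrite big_nil big1 // => y _; rewrite mul0r.
rewrite big_cons IHl => [|y yl]; last by apply: als; rewrite inE yl orbT.
under [RHS]eq_bigr do rewrite /= natrD mulrDl.
rewrite big_split /=; congr (_ + _).
have sa : a \in s by apply: als; rewrite mem_head.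
rewrite (bigD1 (SeqSub sa)) //= eqxx mul1r big1 ?addr0 // => y /negPf ya.
by rewrite [a == _]eq_sym -[_ == a]/(y == SeqSub sa) ya mul0r.
Qed.

(** The matrix entry at (x, y) is the multiplicity of y in the list [D x]. *)
Lemma perron_value_seq (b : R) (s : seq E) (x0 : E) (v : E -> R)
    (D : E -> seq E) :
  x0 \in s -> {in s, forall x, 0 < v x} ->
  {in s, forall x, {subset D x <= s}} ->
  {in s, forall x, b * v x = \sum_(y <- D x) v y} -> perron_value b.
Proof.
move=> x0s v0 Ds vD.
exists (seq_sub s), (fun x => v (val x)),
  (fun x y => count_mem (val y) (D (val x))).
split.
- by apply/card_gt0P; exists (SeqSub x0s).
- by move=> [x xs]; apply: v0.
move=> [x xs] /=; by rewrite vD //; apply: big_sub_count; apply: Ds.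
Qed.

End PositiveCombinations.

(** * Splitting an integer into nearly equal pieces *)

(** The remainder r of n modulo M is spread as an extra 1 over the first r pieces. *)
Lemma sum_divz_pieces (n : int) (M : nat) : (0 < M)%N ->
  \sum_(j < M) ((n %/ M)%Z + (j%:Z < (n %% M)%Z)%R%:Z) = n.
Proof.
move=> M0; rewrite big_split /= sumr_const card_ord.
have M0' : M%:Z != 0 by rewrite eqz_nat -lt0n.
have := modz_ge0 n M0'; have := ltz_pmod n (M0 : 0 < M%:Z).
rewrite [RHS](divz_eq n M) -mulr_natr natz.
case: (n %% M)%Z => // r rM _; congr (_ + _).
rewrite -(big_mkord xpredT (fun j => (j%:Z < r)%R%:Z)).
rewrite (big_cat_nat _ (n := r)) //=; last exact: ltnW.
rewrite [X in _ + X]big_nat_cond [X in _ + X]big1 ?addr0; last first.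
  by move=> j /andP[/andP[rj _] _]; rewrite ltz_nat ltnNge rj.
rewrite big_nat_cond (eq_bigr (fun=> 1)) -?big_nat_cond; last first.
  by move=> j /andP[/andP[_ jr] _]; rewrite ltz_nat jr.
by rewrite sumr_const_nat subn0 natz.
Qed.

Lemma divz_piece_err (R : realFieldType) (n : int) (M j : nat) : (0 < M)%N ->
  `|((n %/ M)%Z + (j%:Z < (n %% M)%Z)%R%:Z)%:~R - n%:~R / M%:R :> R| <= 1.
Proof.
move=> M0.
have M0' : M%:Z != 0 by rewrite eqz_nat -lt0n.
have MR : 0 < M%:R :> R by rewrite ltr0n.
have r0 := modz_ge0 n M0'; have rM := ltz_pmod n (M0 : 0 < M%:Z).
have x0 : 0 <= (n %% M)%Z%:~R / M%:R :> R by rewrite divr_ge0 ?ler0z // ltW.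
have x1 : (n %% M)%Z%:~R / M%:R <= 1 :> R.
  by rewrite ler_pdivrMr // mul1r -[M%:R]/((M%:Z)%:~R) ler_int ltW.
have -> : n%:~R / M%:R = (n %/ M)%Z%:~R + (n %% M)%Z%:~R / M%:R :> R.
  rewrite {1}[n](divz_eq n M) rmorphD rmorphM /= -[M%:~R]/(M%:R) mulrDl mulfK //.
  by rewrite gt_eqF.
rewrite rmorphD /= opprD addrACA subrr add0r ler_norml.
set x := _ / _ in x0 x1 *.
case: (_ < _)%R; [rewrite -[true%:Z%:~R]/(1 : R) | rewrite -[false%:Z%:~R]/(0 : R)]; lra.
Qed.

(** * Finiteness of integer polynomials with bounded values *)

Section BoundedConjugates.
Variable R : realType.
Local Notation C := R[i].
Import ComplexField.Normc.
Implicit Types (u : {poly int}) (z : C).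

Local Notation valR u := (map_poly intr u : {poly R}).
Local Notation valC u := (map_poly intr u : {poly C}).

Lemma valC_real u (c : R) :
  (valC u).[real_complex R c] = real_complex R (valR u).[c].
Proof.
rewrite -horner_map -map_poly_comp; congr (_.[_]); apply: eq_map_poly => n /=.
by rewrite rmorph_int.
Qed.

(* Inverting a Vandermonde matrix bounds the coefficients. *)
Lemma finite_bounded_values (rs : seq C) (T : R) : uniq rs ->
  exists s : seq {poly int}, forall u, (size u <= size rs)%N ->
    {in rs, forall r, normc (valC u).[r] <= T} -> u \in s.
Proof.
move=> rsU; set d := size rs.
pose V := Vandermonde d (\row_(j < d) rs`_j).
have Vu : V \in unitmx.
  rewrite unitmxE unitfE det_Vandermonde.
  apply/prodf_neq0 => i _; apply/prodf_neq0 => j ij.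
  by rewrite !mxE subr_eq0 nth_uniq // gtn_eqF.
have [B SB] : exists B : nat, \sum_k \sum_j T * normc (invmx V j k) <= B%:R.
  by eexists; apply/ltW/(le_lt_trans (ler_norm _))/archi_boundP.
(* Coefficients in [-B, B] are shifted by B to become ordinals; the index type has d + 1 elements,
   one too many, because [inord] needs a successor. *)
exists [seq \poly_(k < d) ((f (inord k))%:Z - B%:Z) | f : {ffun 'I_d.+1 -> 'I_(2 * B).+1}].
move=> u ud uT.
have uB (k : 'I_d) : `|u`_k| <= B%:Z.
  have uV : (\row_(i < d) (u`_i)%:~R) *m V = \row_j (valC u).[rs`_j].
    apply/rowP => j; rewrite !mxE (horner_coef_wide _ (leq_trans (size_poly _ _) ud)).
    by apply: eq_bigr => i _; rewrite !mxE coef_map.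
  have /(canRL (mulmxK Vu))/(congr1 (fun M : 'rV_d => M 0 k)) := uV.
  rewrite !mxE => uk; rewrite -(ler_int R) intr_norm -normc_int uk.
  apply: le_trans (le_normc_sum _ _ _) _.
  have T0 : 0 <= T by apply: le_trans (normc_ge0 _) (uT _ (mem_nth 0 (ltn_ord k))).
  apply: (@le_trans _ _ (\sum_k \sum_j T * normc (invmx V j k))); last first.
    exact: SB.
  rewrite [leRHS](bigD1 k) //= ler_wpDr //.
    by rewrite sumr_ge0 // => i _; rewrite sumr_ge0 // => j _; rewrite mulr_ge0 ?normc_ge0.
  apply: ler_sum => j _; rewrite normcM mxE ler_wpM2r ?normc_ge0 // uT //.
  exact: mem_nth.
pose f := [ffun k : 'I_d.+1 => inord (absz (u`_k + B%:Z)) : 'I_(2 * B).+1].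
apply/fintype.imageP; exists f => //; apply/polyP => k; rewrite coef_poly.
case: ltnP => kd; last by rewrite nth_default // (leq_trans ud).
have /= := uB (Ordinal kd); rewrite ler_norml => /andP[uB1 uB2].
have kE : (inord k : 'I_d.+1) = k :> nat by rewrite inordK // ltnS ltnW.
rewrite ffunE kE; move: (u`_k) uB1 uB2 => x xB Bx; rewrite inordK; lia.
Qed.

End BoundedConjugates.

(** * Lind's argument for strictly dominant integers *)

Section StrictlyDominant.
Variable R : realType.
Local Notation C := R[i].
Import ComplexField.Normc.

Local Notation valR u := (map_poly intr u : {poly R}).
Local Notation valC u := (map_poly intr u : {poly C}).

(** The remainder of X u modulo a monic q of positive degree, when u has smaller degree than q:
    index [(size q).-2] is the highest degree available to u, so one subtraction suffices. *)
Definition shift_mod (q u : {poly int}) := 'X * u - u`_(size q).-2 *: q.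

Lemma size_shift_mod (q u : {poly int}) : q \is monic -> (1 < size q)%N ->
  (size u < size q)%N -> (size (shift_mod q u) < size q)%N.
Proof.
move=> qm q1 uq; rewrite -(prednK (ltnW q1)) ltnS; apply/leq_sizeP => k.
rewrite leq_eqVlt => /orP[/eqP <-|qk].
  rewrite coefB coefXM coefZ -/(lead_coef q) (monicP qm) mulr1.
  by case: (size q) q1 => [|[|n]] //= _; rewrite subrr.
have {}qk : (size q <= k)%N by rewrite -(prednK (ltnW q1)).
rewrite coefB coefXM coefZ [q`_k]nth_default // mulr0 subr0.
case: k qk => // k qk; rewrite /= nth_default //.
by rewrite -ltnS (leq_trans uq).
Qed.

Lemma horner_shift_mod (K : comNzRingType) (q u : {poly int}) (z : K) :
  root (map_poly intr q) z ->
  (map_poly intr (shift_mod q u)).[z] = z * (map_poly intr u).[z].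
Proof.
move=> /rootP qz; rewrite rmorphB rmorphM /= map_polyX map_polyZ.
by rewrite hornerD hornerN hornerZ hornerM hornerX qz mulr0 subr0.
Qed.

(** Since u / M need not have integer coefficients, it is replaced by M rounded versions whose sum
    is exactly u. *)
Definition piece d (u : {poly int}) (M j : nat) : {poly int} :=
  \poly_(k < d) ((u`_k %/ M)%Z + (j%:Z < (u`_k %% M)%Z)%R%:Z).

Lemma sum_pieces d (u : {poly int}) (M : nat) : (0 < M)%N -> (size u <= d)%N ->
  \sum_(j < M) piece d u M j = u.
Proof.
move=> M0 ud; apply/polyP => k; rewrite coef_sum.
under eq_bigr do rewrite coef_poly.
case: ltnP => kd; first exact: sum_divz_pieces.
by rewrite big1 // nth_default // (leq_trans ud).
Qed.

(** Each coefficient is off by at most 1, and |z|^k <= c^k. *)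
Lemma piece_err d (u : {poly int}) (M j : nat) (z : C) (c : R) :
  (0 < M)%N -> (size u <= d)%N -> normc z <= c ->
  normc ((valC (piece d u M j)).[z] - (valC u).[z] / M%:R) <=
    \sum_(k < d) c ^+ k.
Proof.
move=> M0 ud zc.
rewrite (horner_coef_wide z (leq_trans (size_poly _ _) (size_poly _ _))).
rewrite (horner_coef_wide z (leq_trans (size_poly _ _) ud)) mulr_suml -sumrB.
apply: le_trans (le_normc_sum _ _ _) _; apply: ler_sum => k _.
rewrite !coef_map coef_poly ltn_ord mulrAC -mulrBl normcM normcX.
rewrite -[leRHS]mul1r ler_pM ?normc_ge0 ?exprn_ge0 ?normc_ge0 //; last first.
  by rewrite lerXn2r ?nnegrE ?normc_ge0 // (le_trans (normc_ge0 _) zc).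
set n := u`_k; have := divz_piece_err R n j M0; rewrite -normc_realc.
by rewrite (rmorphB (real_complex R)) fmorph_div !(rmorph_int (real_complex R)) rmorph_nat.
Qed.

(** The vertices are the polynomials u satisfying [V] below, which stand for elements of Z[c]; the
    weight of u is u(c), and [D u] decomposes X u modulo q. *)
Lemma perron_value_strict (c : R) (q : {poly int}) (rs : seq C) :
  0 < c -> q \is monic -> map_poly intr q = \prod_(r <- rs) ('X - r%:P) ->
  uniq rs -> real_complex R c \in rs ->
  {in rs, forall r, r != real_complex R c -> normc r < c} -> perron_value c.
Proof.
move=> c0 qm qE rsU crs rsc.
pose d := size rs.
have sq : size q = d.+1.
  rewrite -(size_map_inj_poly (f := intr : int -> C)) ?qE ?size_prod_XsubC //.
  exact: intr_inj.
have d0 : (0 < d)%N by rewrite /d; case: (rs) crs.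
have rq r : r \in rs -> root (valC q) r by rewrite qE root_prod_XsubC.
have cq : root (valR q) c.
  have /rootP := rq _ crs; rewrite valC_real => /(congr1 (@normc R)).
  by rewrite normc0 normc_realc => /eqP; rewrite normr_eq0.
have rle r : r \in rs -> normc r <= c.
  move=> rrs; case: (eqVneq r (real_complex R c)) => [->|rc].
    by rewrite normc_realc gtr0_norm.
  exact/ltW/rsc.
have [delta [dl0 dlc dlr]] : exists delta : R, [/\ 0 < delta, delta <= c &
    {in rs, forall r, r != real_complex R c -> normc r <= c - delta}].
  elim: (rs) rsc => [|r s IHs] sc; first by exists c.
  have [t ts|dl [dl0 dlc dls]] := IHs; first by apply: sc; rewrite inE ts orbT.
  case: (eqVneq r (real_complex R c)) => [rc|rc].
    exists dl; split=> // t; rewrite inE => /orP[/eqP->|]; last exact: dls.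
    by rewrite rc eqxx.
  have := sc r (mem_head _ _) rc; rewrite -subr_gt0 => r0.
  exists (Num.min dl (c - normc r)); rewrite lt_min dl0 r0 ge_min dlc; split=> //.
  move=> t; rewrite inE => /orP[/eqP-> _|ts tc].
    by rewrite lerBrDr -lerBrDl ge_min lexx orbT.
  by rewrite lerBrDr -lerBrDl ge_min lerBrDl -lerBrDr dls.
have [M [M0 cM]] : exists M : nat, (0 < M)%N /\ c < M%:R.
  have cM := archi_boundP (ltW c0).
  by eexists; split; last exact: cM; rewrite -(ltr_nat R) (lt_trans c0).
have MR : 0 < M%:R :> R by rewrite ltr0n.
pose K := \sum_(k < d) c ^+ k.
have K0 : 0 < K.
  rewrite /K; case: (d) d0 => // n _; rewrite big_ord_recl expr0 ltr_pwDl //.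
  by rewrite sumr_ge0 // => i _; rewrite exprn_ge0 // ltW.
(* The first summand puts the constant polynomial 1 in the set. The second gives c T / M + K <= T,
   so that pieces stay below T; this is why M > c. The third gives 2 K <= delta T / (c M), so that
   the gap beats the rounding errors. *)
pose T := 1 + K * M%:R / (M%:R - c) + 2 * K * c * M%:R / delta.
have Mc : 0 < M%:R - c by rewrite subr_gt0.
have T1 : 1 <= T.
  by rewrite /T -addrA lerDl addr_ge0 // divr_ge0 // ?mulr_ge0 // ltW.
have TM : c * T / M%:R + K <= T.
  have : K * M%:R / (M%:R - c) <= T.
    by rewrite /T addrAC lerDr addr_ge0 // divr_ge0 // ?mulr_ge0 // ltW.
  rewrite ler_pdivrMr // => KT.
  by rewrite -lerBrDr ler_pdivrMr // mulrBl lerBrDr; lra.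
have TD : 2 * K <= delta * T / c / M%:R.
  have : 2 * K * c * M%:R / delta <= T.
    by rewrite /T lerDr addr_ge0 // divr_ge0 // ?mulr_ge0 // ltW.
  by rewrite ler_pdivrMr // !ler_pdivlMr // mulrAC [T * _]mulrC mulrAC.
(* A value of T or less at c leaves finitely many u; when c u(c) > T, the strict gap delta at the
   other roots absorbs the rounding error K of splitting X u into M pieces. *)
pose V (u : {poly int}) := [&& (size u <= d)%N, 0 < (valR u).[c],
  (valR u).[c] <= T & all (fun r => normc (valC u).[r] <= (valR u).[c]) rs].
have [s0 s0P] := finite_bounded_values T rsU.
pose s := [seq u <- s0 | V u].
have sP u : (u \in s) = V u.
  rewrite mem_filter; case: (boolP (V u)) => //= /and4P[ud u0 uT /allP ur].
  by rewrite s0P // => r rrs; apply: le_trans (ur r rrs) uT.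
pose D u := if c * (valR u).[c] <= T then [:: shift_mod q u]
            else [seq piece d (shift_mod q u) M j | j <- iota 0 M].
apply: (@perron_value_seq _ _ c s 1 (fun u => (valR u).[c]) D).
- rewrite sP /V size_poly1 d0 rmorph1 hornerC ltr01 T1 /=.
  by apply/allP => r _; rewrite rmorph1 hornerC normc1.
- by move=> u; rewrite sP => /and4P[].
- move=> u; rewrite sP => /and4P[ud u0 uT /allP ur] w.
  have sh : (size (shift_mod q u) <= d)%N.
    by rewrite -ltnS -sq size_shift_mod ?sq // ltnS.
  have shr r : r \in rs -> normc (valC (shift_mod q u)).[r] = normc r * normc (valC u).[r].
    by move=> rrs; rewrite horner_shift_mod ?normcM //; apply: rq.
  have shc : (valR (shift_mod q u)).[c] = c * (valR u).[c].
    by rewrite horner_shift_mod.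
  rewrite /D; case: leP => [cuT|Tcu].
    rewrite inE => /eqP ->; rewrite sP /V sh shc mulr_gt0 // cuT /=.
    by apply/allP => r rrs; rewrite shr // ler_pM ?normc_ge0 ?rle ?ur.
  move=> /mapP[j _ ->]; rewrite sP /V (leq_trans (size_poly _ _)) //=.
  set w' := piece _ _ _ _.
  have err r : r \in rs -> normc ((valC w').[r] - (valC (shift_mod q u)).[r] / M%:R) <= K.
    by move=> rrs; rewrite piece_err // rle.
  have errc : `|(valR w').[c] - c * (valR u).[c] / M%:R| <= K.
    have := err _ crs; rewrite !valC_real -shc.
    rewrite -[M%:R in X in X -> _](rmorph_nat (real_complex R)).
    by rewrite -fmorph_div -rmorphB normc_realc.
  (* Here u(c) > T / c, so [TD] passes to u(c). With delta <= c it also yields c u(c) / M >= 2 K,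
     whence the piece has value at least K > 0 at c. *)
  have uD : 2 * K <= delta * (valR u).[c] / M%:R.
    apply: le_trans TD _; rewrite ler_pM2r ?invr_gt0 // -mulrA ler_pM2l //.
    by rewrite ler_pdivrMr // mulrC ltW.
  have dlu : delta * (valR u).[c] / M%:R <= c * (valR u).[c] / M%:R.
    by rewrite ler_pM2r ?invr_gt0 // ler_pM2r.
  have cuM : c * (valR u).[c] / M%:R <= c * T / M%:R.
    by rewrite ler_pM2r ?invr_gt0 // ler_pM2l.
  move: errc; rewrite ler_norml => /andP[errc1 errc2].
  apply/and3P; split; [lra | lra |].
  apply/allP => r rrs; case: (eqVneq r (real_complex R c)) => [->|rc].
    rewrite valC_real normc_realc ger0_norm //; lra.
  (* At the other roots |w'(r)| <= K + (c - delta) u(c) / M <= c u(c) / M - K <= w'(c). *)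
  have wr : normc (valC w').[r] <=
      K + normc (valC (shift_mod q u)).[r] / M%:R.
    rewrite -[(valC w').[r]](subrK ((valC (shift_mod q u)).[r] / M%:R)).
    apply: le_trans (le_normcD _ _) _; rewrite lerD ?err //.
    by rewrite normcM normcV -(rmorph_nat (real_complex R)) normc_realc normr_nat.
  have ru : normc (valC (shift_mod q u)).[r] / M%:R <=
      c * (valR u).[c] / M%:R - delta * (valR u).[c] / M%:R.
    rewrite -mulrBl -mulrBl ler_pM2r ?invr_gt0 // shr //.
    by rewrite ler_pM ?normc_ge0 ?dlr ?ur.
  apply: le_trans wr _; move: ru uD errc1.
  move: (valR w').[c] (normc _ / _) (c * _ / _) (delta * _ / _) => t a e f.
  by clear; lra.
- move=> u; rewrite sP => /and4P[ud u0 uT ur].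
  have shc : (valR (shift_mod q u)).[c] = c * (valR u).[c].
    by rewrite horner_shift_mod.
  rewrite /D; case: ifP => _; first by rewrite big_seq1.
  rewrite big_map -shc.
  have sh : (size (shift_mod q u) <= d)%N.
    by rewrite -ltnS -sq size_shift_mod ?sq // ltnS.
  rewrite -{1}(sum_pieces M0 sh) rmorph_sum horner_sum -val_enum_ord.
  by rewrite big_map big_enum.
Qed.

End StrictlyDominant.

(** * Minimal polynomials over the rationals *)

Section MinimalPolynomials.
Variable F : numFieldType.
Implicit Types (b : F) (p q : {poly rat}).

(* Over the reals this is convertible to irreducible_polynomial_of. *)
Definition minimal_polynomial b p : Prop :=
  [/\ p \is monic, root (map_poly ratr p) b &
      forall q, q != 0 -> root (map_poly ratr q) b -> (size p <= size q)%N].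

Lemma minimal_polynomial_dvd b p q : minimal_polynomial b p ->
  root (map_poly ratr q) b -> p %| q.
Proof.
move=> [pm pb pmin] qb; rewrite /dvdp; have [//|m0] := eqVneq (q %% p) 0.
have := ltn_modpN0 q (monic_neq0 pm); rewrite ltnNge pmin //.
move: qb; rewrite {1}(divp_eq q p) rmorphD rmorphM /= /root hornerD hornerM.
by rewrite (rootP pb) mulr0 add0r.
Qed.

Lemma minimal_polynomial_irreducible b p :
  minimal_polynomial b p -> irreducible_poly p.
Proof.
move=> bp; have [pm pb pmin] := bp; split.
  rewrite ltnNge; apply: contraL pb => p1.
  have := pm; rewrite (size1_polyC p1) monicE lead_coefC => /eqP ->.
  by rewrite rmorph1 root1.
move=> q q1 /dvdpP[r rE]; have p0 := monic_neq0 pm.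
have [r0 q0] : r != 0 /\ q != 0.
  by apply/andP; rewrite -negb_or -mulf_eq0 -rE.
have := pb; rewrite rE rmorphM rootM => /orP[rb|qb].
  have q2 : (1 < size q)%N by rewrite ltn_neqAle eq_sym q1 lt0n size_poly_eq0.
  have := pmin r r0 rb; rewrite rE size_mul // leqNgt.
  by case: (size q) q2 => [|[|k]] // _; rewrite !addnS /= ltnS leq_addr.
rewrite -rE /eqp (minimal_polynomial_dvd bp qb) andbT.
by rewrite rE dvdp_mull.
Qed.

(** By irreducibility, a nontrivial gcd with the derivative would make p divide p', which is nonzero
    of smaller degree. *)
Lemma minimal_polynomial_separable b p :
  minimal_polynomial b p -> separable_poly p.
Proof.
move=> bp; have [pm pb pmin] := bp; have p0 := monic_neq0 pm.
have pirr := minimal_polynomial_irreducible bp.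
have p1 := pirr.1; rewrite unlock /coprimep.
apply/negPn/negP => g1; have /andP[_ pg] := pirr.2 _ g1 (dvdp_gcdl _ _).
have := dvdp_trans pg (dvdp_gcdr _ _); apply/negP.
rewrite gtNdvdp ?lt_size_deriv // -size_poly_eq0 polyorder.size_deriv.
by move: (size p) p1; lia.
Qed.

Lemma minimal_polynomial_root (K : numFieldType) b p q (z : K) :
  minimal_polynomial b p -> root (map_poly ratr q) b ->
  root (map_poly ratr p) z -> root (map_poly ratr q) z.
Proof.
move=> bp qb pz; have /dvdpP[r ->] := minimal_polynomial_dvd bp qb.
by rewrite rmorphM rootM pz orbT.
Qed.

Lemma map_ratr_int (K : numFieldType) (q : {poly int}) :
  map_poly ratr (map_poly intr q) = map_poly intr q :> {poly K}.
Proof.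
by rewrite -map_poly_comp; apply: eq_map_poly => n /=; rewrite ratr_int.
Qed.

Lemma minimal_polynomial_ex b : integralOver (intr : int -> F) b ->
  exists p, minimal_polynomial b p.
Proof.
move=> [q qm qb]; rewrite -map_ratr_int in qb.
pose P n := `[< exists q', [/\ q' != 0, root (map_poly ratr q') b & size q' = n :> nat] >].
have exP : exists n, P n.
  exists (size (map_poly intr q : {poly rat})); apply/asboolP.
  exists (map_poly intr q); split=> //; apply: monic_neq0.
  exact: monic_map.
have [n /asboolP[p [p0 pb pn]] nmin] := ex_minnP exP.
exists ((lead_coef p)^-1 *: p); split.
- by rewrite monicE lead_coefZ mulVf // lead_coef_eq0.
- by rewrite map_polyZ rootZ // fmorph_eq0 invr_eq0 lead_coef_eq0.
- move=> r r0 rb; rewrite size_scale ?invr_eq0 ?lead_coef_eq0 // pn.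
  by apply: nmin; apply/asboolP; exists r.
Qed.

(** Gauss's lemma: p is proportional to an integer factor of the monic q, and such a factor has
    leading coefficient 1 or -1. *)
Lemma minimal_polynomial_int b p :
  minimal_polynomial b p -> integralOver (intr : int -> F) b ->
  exists2 q : {poly int}, q \is monic & p = map_poly intr q.
Proof.
move=> bp [q qm qb]; rewrite -map_ratr_int in qb.
have [pm _ _] := bp.
have /dvdpP_rat_int[p1 [a a0 pE] [r qE]] := minimal_polynomial_dvd bp qb.
have : lead_coef p1 * lead_coef r = 1 by rewrite -lead_coefM -qE (monicP qm).
move=> l1; have l_sqr : lead_coef p1 * lead_coef p1 = 1.
  by have := intUnitRing.unitzPl (etrans (mulrC _ _) l1); case/orP=> /eqP ->.
have aE : a = (lead_coef p1)%:~R.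
  have := monicP pm; rewrite pE lead_coefZ lead_coef_map_inj //; last exact: intr_inj.
  have l_sqr' : (lead_coef p1)%:~R * (lead_coef p1)%:~R = 1 :> rat.
    by rewrite -intrM l_sqr.
  by move/(congr1 (fun x => x * (lead_coef p1)%:~R)); rewrite -mulrA l_sqr' mulr1 mul1r.
exists (lead_coef p1 *: p1); first by rewrite monicE lead_coefZ l_sqr.
by rewrite pE aE map_polyZ.
Qed.

End MinimalPolynomials.

(** * Joint eigenvectors, and eigenvalues of powers and of pairs *)

Section JointEigenvectors.
Variable C : closedFieldType.

Lemma eigenvalue_ex n (A : 'M[C]_n) : (0 < n)%N -> exists a, eigenvalue A a.
Proof.
move=> n0; have /closed_rootP[a Aa] : size (char_poly A) != 1%N.
  by rewrite size_char_poly; case: (n) n0.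
by exists a; rewrite eigenvalue_root_char.
Qed.

(** A preserves the eigenspace of B for mu; [D] is the matrix of its restriction, and any
    eigenvector of [D] will do. *)
Lemma commuting_eigenvector n (A B : 'M[C]_n) (mu : C) :
  A *m B = B *m A -> eigenvalue B mu ->
  exists (la : C) (v : 'rV_n), [/\ v != 0, v *m A = la *: v & v *m B = mu *: v].
Proof.
move=> AB Bmu; pose W := row_base (eigenspace B mu).
have WB : W *m B = mu *: W by apply/eigenspaceP; rewrite eq_row_base.
have /submxP[D WA] : (W *m A <= W)%MS.
  rewrite eq_row_base; apply/eigenspaceP.
  by rewrite -mulmxA AB mulmxA WB scalemxAl.
have [|la /eigenvalueP[u uD u0]] := eigenvalue_ex D.
  by rewrite lt0n mxrank_eq0.
exists la, (u *m W); split.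
- by rewrite mulmx_free_eq0 ?row_base_free.
- by rewrite -mulmxA WA mulmxA uD scalemxAl.
- by rewrite -mulmxA WB -scalemxAr.
Qed.

(** A commutes with A^N; on a joint eigenvector A^N acts both as mu and as la^N. *)
Lemma eigenvalue_exp n (A : 'M[C]_n) (N : nat) (mu : C) :
  eigenvalue (A ^+ N) mu -> exists2 la, eigenvalue A la & mu = la ^+ N.
Proof.
move=> /(commuting_eigenvector (A := A))[|la [v [v0 vA vmu]]].
  by have := commrX N (commr_refl A).
exists la; first by apply/eigenvalueP; exists v.
move: vmu.
have -> : v *m A ^+ N = la ^+ N *: v.
  elim: N => [|N IHN]; first by rewrite !expr0 mulmx1 scale1r.
  by rewrite exprSr -mulmxE mulmxA IHN -scalemxAl vA scalerA exprSr.
move/eqP; rewrite -subr_eq0 -scalerBl scaler_eq0 (negPf v0) orbF subr_eq0.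
by move/eqP/esym.
Qed.

Lemma eigenvalue_expr n (A : 'M[C]_n) (N : nat) (la : C) :
  eigenvalue A la -> eigenvalue (A ^+ N) (la ^+ N).
Proof.
move=> /eigenvalueP[v vA v0]; apply/eigenvalueP; exists v => //.
elim: N => [|N IHN]; first by rewrite !expr0 mulmx1 scale1r.
by rewrite exprSr -mulmxE mulmxA IHN -scalemxAl vA scalerA exprSr.
Qed.

End JointEigenvectors.

(* The matrix of X |-> A^T X A, whose eigenvalues are the products of two eigenvalues of A. *)
Definition pair_mx (K : comNzRingType) n (A : 'M[K]_n) : 'M[K]_(n * n) :=
  lin_mx (mulmx A^T \o mulmxr A).

Lemma map_pair_mx (K L : comNzRingType) (f : {rmorphism K -> L}) n
  (A : 'M[K]_n) : map_mx f (pair_mx A) = pair_mx (map_mx f A).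
Proof.
by rewrite /pair_mx; apply: map_lin_mx => X /=; rewrite !map_mxM map_trmx.
Qed.

Section PairEigenvalues.
Variable C : closedFieldType.

(** The eigenvector is the rank one matrix v^T w, as A^T v^T w A = (v A)^T (w A). *)
Lemma eigenvalue_pair_mx n (A : 'M[C]_n) (la nu : C) :
  eigenvalue A la -> eigenvalue A nu -> eigenvalue (pair_mx A) (la * nu).
Proof.
move=> /eigenvalueP[v vA v0] /eigenvalueP[w wA w0].
apply/eigenvalueP; exists (mxvec (v^T *m w)).
  rewrite mul_vec_lin /= !mulmxA -trmx_mul vA -mulmxA wA.
  have -> : (la *: v)^T = la *: v^T by rewrite linearZ.
  by rewrite -scalemxAr -scalemxAl !linearZ /= scalerA mulrC.
rewrite mxvec_eq0; have /rV0Pn[i vi] := v0; have /rV0Pn[j wj] := w0.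
apply/eqP => /matrixP/(_ i j)/eqP; rewrite !mxE big_ord1 !mxE.
by rewrite mulf_eq0 (negPf vi) (negPf wj).
Qed.

(** X |-> X A commutes with X |-> A^T X A, so some nonzero X has X A = la X and A^T X A = mu X. The
    nonzero rows of X are eigenvectors for la; if la is nonzero, A^T X = (mu / la) X and the nonzero
    columns give mu / la. *)
Lemma pair_mx_eigenvalue n (A : 'M[C]_n) (mu : C) : eigenvalue (pair_mx A) mu ->
  exists la nu, [/\ eigenvalue A la, eigenvalue A nu & mu = la * nu].
Proof.
move=> Amu; have cAA : lin_mx (mulmxr A) *m pair_mx A = pair_mx A *m lin_mx (mulmxr A).
  apply/row_matrixP => i; rewrite !rowE.
  by rewrite -[delta_mx 0 i]vec_mxK !mulmxA !mul_vec_lin /= !mulmxA.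
have [la [y []]] := commuting_eigenvector cAA Amu.
rewrite -[y]vec_mxK; move: (vec_mx y) => X.
rewrite !mul_vec_lin /= mxvec_eq0 -!linearZ /=.
move=> X0 /(can_inj mxvecK) XA /(can_inj mxvecK).
rewrite XA -scalemxAr => AX.
have [i Xi] : exists i, row i X != 0.
  apply/existsP; apply: contraNT X0; rewrite negb_exists => /forallP X0.
  by apply/eqP/row_matrixP => i; apply/eqP; rewrite row0; apply/negPn.
have [j Xj] : exists j, row j X^T != 0.
  apply/existsP; rewrite -trmx_eq0 in X0; apply: contraNT X0.
  rewrite negb_exists => /forallP X0.
  by apply/eqP/row_matrixP => j; apply/eqP; rewrite row0; apply/negPn.
have Ala : eigenvalue A la.
  by apply/eigenvalueP; exists (row i X); rewrite // -row_mul XA linearZ.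
(* If la = 0 then mu = 0 too, and la serves as both factors. *)
have [la0|la0] := eqVneq la 0.
  exists la, la; split=> //; move: AX; rewrite la0 scale0r mul0r => /esym/eqP.
  by rewrite scaler_eq0 (negPf X0) orbF => /eqP.
exists la, (la^-1 * mu); split=> //; last by rewrite mulVKf.
apply/eigenvalueP; exists (row j X^T); rewrite // -row_mul.
have -> : X^T *m A = (la^-1 * mu) *: X^T.
  by rewrite -[A]trmxK -trmx_mul -linearZ -scalerA -AX scalerA mulVf // scale1r.
by rewrite linearZ.
Qed.

End PairEigenvalues.

(** * Spectral radii of integer matrices dominate their conjugates *)

Section IntegerMatrices.
Variable R : realType.
Local Notation C := R[i].
Import ComplexField.Normc.

Lemma root_realc (q : {poly int}) (x : R) :
  root (map_poly intr q : {poly C}) (real_complex R x) =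
  root (map_poly intr q : {poly R}) x.
Proof. by rewrite /root valC_real fmorph_eq0. Qed.

Lemma root_conjc (q : {poly int}) (z : C) :
  root (map_poly intr q) z -> root (map_poly intr q) (conjc z).
Proof.
rewrite -complex_root_conj -map_poly_comp.
congr (is_true (root _ _)); apply: eq_map_poly => n /=.
by rewrite rmorph_int.
Qed.

Lemma eigenvalue_int n (A : 'M[int]_n) (z : C) :
  eigenvalue (map_mx intr A) z = root (map_poly intr (char_poly A)) z.
Proof. by rewrite eigenvalue_root_char map_char_poly. Qed.

Lemma dominant_eigenvalue_conjugates n (A : 'M[int]_n) (la : C) :
  eigenvalue (map_mx intr A) la ->
  (forall z, eigenvalue (map_mx intr A) z -> normc z <= normc la) ->
  integralOver (intr : int -> R) (normc la) /\
  exists2 p, minimal_polynomial (normc la) p &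
    forall z : C, root (map_poly ratr p) z -> normc z <= normc la.
Proof.
move=> Ala Amax; set b := normc la.
(* A monic integer polynomial whose roots are the square roots of the eigenvalues of [pair_mx A]; b
   is one, since b^2 = la * conj la. *)
pose q := char_poly (pair_mx A) \Po 'X^2.
have qm : q \is monic.
  rewrite monicE lead_coef_comp ?size_polyXn // lead_coefXn expr1n mulr1 -monicE.
  exact: char_poly_monic.
have qE (K : comNzRingType) (z : K) :
    root (map_poly intr q) z = root (map_poly intr (char_poly (pair_mx A))) (z ^+ 2).
  by rewrite /root map_comp_poly map_polyXn horner_comp hornerXn.
have qb : root (map_poly intr q) b.
  rewrite qE -root_realc -mulcJ -eigenvalue_int map_pair_mx.
  apply: (eigenvalue_pair_mx Ala).
  by rewrite eigenvalue_int; apply: root_conjc; rewrite -eigenvalue_int; apply: Ala.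
have bi : integralOver (intr : int -> R) b by exists q.
split=> //; have [p bp] := minimal_polynomial_ex bi; exists p => // z pz.
rewrite -map_ratr_int in qb.
have := minimal_polynomial_root bp qb pz.
rewrite map_ratr_int qE -eigenvalue_int map_pair_mx.
move=> /pair_mx_eigenvalue[x [y [Ax Ay zxy]]].
rewrite -(ler_pXn2r (n := 2)) ?nnegrE ?normc_ge0 // -normcX zxy normcM.
rewrite expr2.
exact: ler_pM (normc_ge0 x) (normc_ge0 y) (Amax x Ax) (Amax y Ay).
Qed.

End IntegerMatrices.

(** * Conjugation through Q[X]/(p), and quotients of roots *)

Section Conjugation.

Lemma horner_rmodp (L : numFieldType) (p q : {poly rat}) (z : L) : p \is monic ->
  root (map_poly ratr p) z ->
  (map_poly ratr (Pdiv.CommonRing.rmodp q p)).[z] = (map_poly ratr q).[z].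
Proof.
move=> pm /rootP pz; rewrite [in RHS](Pdiv.RingMonic.rdivp_eq pm q).
by rewrite rmorphD rmorphM /= hornerD hornerM pz mulr0 add0r.
Qed.

(** The field is Q[X]/(p) with x the class of X. Its embeddings at the various roots replace Galois
    automorphisms of a splitting field. *)
Lemma adjoin_root (p : {poly rat}) : monic_irreducible_poly p ->
  exists (K : fieldType) (x : K), forall (L : numFieldType) (z : L),
    root (map_poly ratr p) z -> exists f : {rmorphism K -> L}, f x = z.
Proof.
move=> pI; exists {poly %/ p with pI}, (in_qpoly p 'X) => L z pz.
have pm := monic_mk_monic p.
have {}pz : root (map_poly ratr (mk_monic p)) z by rewrite mk_monicE.
pose f (u : {poly %/ p with pI}) : L := (map_poly ratr (u : {poly rat})).[z].
have fD : zmod_morphism f.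
  by move=> u v; rewrite /f rmorphB /= hornerD hornerN.
have fM : monoid_morphism f.
  split; first by rewrite /f /= rmorph1 hornerC.
  move=> u v; rewrite /f poly_of_qpolyM (horner_rmodp _ pm pz).
  by rewrite rmorphM hornerM.
pose fM' := GRing.isMonoidMorphism.Build _ _ f fM.
pose fD' := GRing.isZmodMorphism.Build _ _ f fD.
pose F : {rmorphism {poly %/ p with pI} -> L} := HB.pack f fM' fD'.
by exists F; rewrite /= /f /= (horner_rmodp _ pm pz) map_polyX hornerX.
Qed.

End Conjugation.

(** The gcd is, up to a unit, the product over the common roots. This turns a count of roots into a
    degree, which field embeddings preserve. *)
Lemma size_gcdp_prod_XsubC (K : fieldType) (rs : seq K) (q : {poly K}) : uniq rs ->
  size (gcdp (\prod_(r <- rs) ('X - r%:P)) q) = (size [seq r <- rs | root q r]).+1.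
Proof.
move=> rsU; set P := \prod_(r <- rs) _.
have P0 : P != 0 by rewrite monic_neq0 ?monic_prod_XsubC.
have g0 : gcdp P q != 0 by rewrite gcdp_eq0 (negPf P0).
apply/eqP; rewrite eqn_leq; apply/andP; split.
  have [m gm] := dvdp_prod_XsubC (dvdp_gcdl P q).
  rewrite (eqp_size gm) size_prod_XsubC ltnS uniq_leq_size ?mask_uniq // => r rm.
  rewrite mem_filter (mem_mask rm) andbT.
  rewrite -dvdp_XsubCl; apply: dvdp_trans (dvdp_gcdr P q).
  by rewrite dvdp_XsubCl (eqp_root gm) root_prod_XsubC.
rewrite -(size_prod_XsubC _ id) dvdp_leq // dvdp_gcd.
apply/andP; split; apply: uniq_roots_dvdp; rewrite ?uniq_rootsE ?filter_uniq //.
  by apply/allP => r; rewrite mem_filter root_prod_XsubC => /andP[].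
by apply/allP => r; rewrite mem_filter => /andP[].
Qed.

(* Y^d p(t / Y) *)
Definition quotient_poly (K : fieldType) (p : {poly int}) (t : K) : {poly K} :=
  \poly_(j < size p) ((p`_((size p).-1 - j))%:~R * t ^+ ((size p).-1 - j)).

Lemma map_quotient_poly (K L : fieldType) (f : {rmorphism K -> L}) p t :
  map_poly f (quotient_poly p t) = quotient_poly p (f t).
Proof.
apply/polyP => j; rewrite coef_map !coef_poly /=; case: ifP => _; last exact: rmorph0.
by rewrite (rmorphM f) (rmorphXn f) (rmorph_int f).
Qed.

Lemma horner_quotient_poly (K : fieldType) (p : {poly int}) (t r : K) : r != 0 ->
  (quotient_poly p t).[r] = r ^+ (size p).-1 * (map_poly intr p).[t / r].
Proof.
move=> r0; rewrite horner_poly (horner_coef_wide _ (size_poly _ _)) mulr_sumr.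
rewrite (reindex_inj rev_ord_inj) /=; apply: eq_bigr => j _.
have -> : (size p - j.+1 = (size p).-1 - j)%N by rewrite -subn1 -subnDA add1n.
have jd : (j <= (size p).-1)%N by rewrite -ltnS (ltn_predK (ltn_ord j)) ltn_ord.
rewrite coef_map /= subKn // exprMn exprVn mulrCA -!mulrA; congr (_ * _).
by rewrite mulrCA; congr (_ * _); rewrite -{2}(subnK jd) exprD -mulrA mulfV ?mulr1 // expf_neq0.
Qed.

(** * Conjugates of maximal modulus *)

Section RootsOnCircle.
Variable R : realType.
Local Notation C := R[i].
Import ComplexField.Normc.

Variables (b : R) (p : {poly int}) (rs : seq C).
Hypotheses (b0 : 0 < b) (bp : minimal_polynomial b (map_poly intr p)).
Hypothesis pE : map_poly intr p = \prod_(r <- rs) ('X - r%:P).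
Hypotheses (rsU : uniq rs) (rsb : {in rs, forall r, normc r <= b}).

Local Notation B := (real_complex R b).

Lemma mem_rs r : (r \in rs) = root (map_poly intr p) r.
Proof. by rewrite pE root_prod_XsubC. Qed.

Lemma b_mem_rs : B \in rs.
Proof. by rewrite mem_rs root_realc; case: bp => _; rewrite map_ratr_int. Qed.

Let p_monic : p \is monic.
Proof.
case: bp; rewrite !monicE lead_coef_map_inj // => [/eqP pm _ _|]; last exact: intr_inj.
by rewrite -(inj_eq (intr_inj (R := rat))) pm.
Qed.

(* Both sides are the degree of a gcd computed in Q[X]/(p), transported along X |-> g and X |-> b. *)
Lemma count_quotient_roots (g : C) : g \in rs ->
  size [seq r <- rs | root (quotient_poly p (g ^+ 2)) r] =
  size [seq r <- rs | root (quotient_poly p (B ^+ 2)) r].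
Proof.
have pI : monic_irreducible_poly (map_poly intr p : {poly rat}).
  by split; [exact: minimal_polynomial_irreducible bp | case: bp].
have [K [x Kx]] := adjoin_root pI.
have count z : z \in rs ->
    (size [seq r <- rs | root (quotient_poly p (z ^+ 2)) r]).+1 =
    size (gcdp (map_poly intr p) (quotient_poly p (x ^+ 2))).
  rewrite mem_rs -map_ratr_int => /Kx[f fx].
  rewrite -size_gcdp_prod_XsubC // -pE -fx -rmorphXn -(map_quotient_poly f).
  have -> : map_poly intr p = map_poly f (map_poly intr p) :> {poly C}.
    by rewrite -map_poly_comp; apply: eq_map_poly => n /=; rewrite rmorph_int.
  by rewrite -gcdp_map size_map_poly.
by move=> gr; apply: succn_inj; rewrite !count ?b_mem_rs.
Qed.

Lemma mem_quotient_roots (t r : C) : r != 0 ->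
  root (quotient_poly p t) r = (t / r \in rs).
Proof.
by move=> r0; rewrite mem_rs /root horner_quotient_poly // mulf_eq0 expf_eq0 (negPf r0) andbF.
Qed.

Let circle := [seq r <- rs | normc r == b].

(** If r and t / r are both conjugates, then |r| <= b and b^2 / |r| <= b, so |r| = b. *)
Lemma quotient_roots_circle (t : C) : t != 0 -> normc t = b ^+ 2 ->
  {subset [seq r <- rs | root (quotient_poly p t) r] <= circle}.
Proof.
move=> t0 tb r; rewrite !mem_filter => /andP[tr rrs]; rewrite rrs andbT.
(* Zero is no root: the constant coefficient of [quotient_poly p t] is a power of t. *)
have [r0|r0] := eqVneq r 0.
  move: tr; rewrite r0 /root horner_coef0 coef_poly.
  rewrite size_poly_gt0 (monic_neq0 p_monic) subn0 -/(lead_coef p) (monicP p_monic) mul1r expf_eq0.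
  by rewrite (negPf t0) andbF.
move: tr; rewrite mem_quotient_roots // => /rsb; rewrite normcM normcV tb.
rewrite ler_pdivrMr ?normc_gt0 // expr2 ler_pM2l // => br.
by rewrite eq_le br rsb.
Qed.

(** For t = b^2 every s on the circle is a root of [quotient_poly p t], as b^2 / s = conj s. For t =
    g^2 there are equally many roots, again on the circle, so they fill it. *)
Lemma circle_quotient g r : g \in circle -> r \in circle -> g ^+ 2 / r \in circle.
Proof.
rewrite [g \in _]mem_filter => /andP[/eqP gb grs] rc.
have [rb rrs] : normc r = b /\ r \in rs by move: rc; rewrite mem_filter => /andP[/eqP].
have g0 : g != 0 by rewrite -normc_gt0 gb.
have r0 : r != 0 by rewrite -normc_gt0 rb.
have g2b : normc (g ^+ 2) = b ^+ 2 by rewrite normcX gb.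
have : r \in [seq r <- rs | root (quotient_poly p (g ^+ 2)) r].
  have [|_ ->] // := uniq_min_size (filter_uniq _ rsU)
    (quotient_roots_circle (expf_neq0 2 g0) g2b).
  rewrite count_quotient_roots //; apply: uniq_leq_size; first exact: filter_uniq.
  move=> s; rewrite !mem_filter => /andP[/eqP sb srs]; rewrite srs andbT.
  have s0 : s != 0 by rewrite -normc_gt0 sb.
  rewrite mem_quotient_roots //.
  have -> : B ^+ 2 = s * conjc s by rewrite mulcJ sb rmorphXn.
  rewrite mulrAC mulfV // mul1r.
  by rewrite mem_rs root_conjc // -mem_rs.
rewrite mem_filter mem_quotient_roots // => /andP[gr _].
by rewrite mem_filter gr normcM normcV g2b rb expr2 mulfK ?eqxx ?gt_eqF.
Qed.

Lemma circle_conj r : r \in circle -> conjc r \in circle.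
Proof.
rewrite !mem_filter normcJc => /andP[-> rrs].
by rewrite mem_rs root_conjc // -mem_rs.
Qed.

(* Multiplication by (g / b)^2 permutes the roots on the circle. *)
Lemma circle_root_of_unity :
  exists N, {in rs, forall g, normc g = b -> g ^+ N.+1 = B ^+ N.+1}.
Proof.
have cb : B \in circle by rewrite mem_filter b_mem_rs normc_realc gtr0_norm ?eqxx.
have B0 : B != 0 by rewrite -normc_gt0 normc_realc gtr0_norm.
(* With n roots on the circle, [h] multiplies their product by (g / b)^(2 n), which must therefore
   be 1; the predecessor fits [N.+1]. *)
exists (2 * size circle).-1 => g grs gb.
rewrite prednK; last by rewrite muln_gt0 /=; case: circle cb.
have gc : g \in circle by rewrite mem_filter grs gb eqxx.
have circle0 : {in circle, forall s, s != 0}.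
  by move=> s; rewrite mem_filter -normc_gt0 => /andP[/eqP->].
have circleU : uniq circle by rewrite filter_uniq.
pose h s := (g / B) ^+ 2 * s.
have g0 : g != 0 by rewrite -normc_gt0 gb.
have gB0 : (g / B) ^+ 2 != 0 by rewrite expf_neq0 // mulf_neq0 // invr_eq0.
have hc s : s \in circle -> h s \in circle.
  (* On the circle s * conj s = b^2, so [h] is conjugation followed by r |-> g^2 / r, and both
     preserve the circle. *)
  move=> sc; have sE : h s = g ^+ 2 / conjc s.
    have cs0 : conjc s != 0 by rewrite conjc_eq0 circle0.
    have : s * conjc s = B ^+ 2.
      move: sc; rewrite mem_filter => /andP[/eqP sb _].
      by rewrite mulcJ sb rmorphXn.
    rewrite /h expr_div_n => <-; rewrite invfM -!mulrA; congr (_ * _).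
    by rewrite [s^-1 * _]mulrCA mulVf ?mulr1 // circle0.
  by rewrite sE circle_quotient // circle_conj.
have ph : perm_eq circle (map h circle).
  apply: uniq_perm => //; first by rewrite map_inj_uniq //; exact: mulfI.
  have hU : uniq (map h circle) by rewrite map_inj_uniq //; exact: mulfI.
  have [||_ hE] // := uniq_min_size hU (s2 := circle).
  - by move=> _ /mapP[s sc ->]; apply: hc.
  - by rewrite size_map.
have := perm_big _ ph (op := *%R) (x := 1) (P := xpredT) (F := id) => /=.
rewrite big_map big_split /= big_const_seq count_predT iter_mulr_1.
rewrite -[X in X = _]mul1r => /mulIf.
have p0 : \prod_(i <- circle) i != 0.
  by rewrite prodf_seq_neq0; apply/allP => s /circle0.
move=> /(_ p0) /esym; rewrite -exprM expr_div_n => /(canRL (mulfVK _)).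
by rewrite expf_neq0 // mul1r; apply.
Qed.

End RootsOnCircle.

(** * Dominant algebraic integers are Perron values *)

Section DominantIntegers.
Variable R : realType.
Local Notation C := R[i].
Import ComplexField.Normc.

Lemma minimal_polynomial_split (b : R) (q : {poly int}) :
  q \is monic -> minimal_polynomial b (map_poly intr q) ->
  exists2 rs : seq C, uniq rs & map_poly intr q = \prod_(r <- rs) ('X - r%:P).
Proof.
move=> qm bq.
have [rs qE] := closed_field_poly_normal (map_poly intr q : {poly C}).
have {}qE : map_poly intr q = \prod_(r <- rs) ('X - r%:P) :> {poly C}.
  by rewrite {1}qE lead_coef_map_inj ?(monicP qm) ?scale1r //; exact: intr_inj.
exists rs => //; rewrite -separable_prod_XsubC -qE -map_ratr_int.
by rewrite separable_map (minimal_polynomial_separable bq).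
Qed.

Lemma dominant_perron_value (b : R) (p : {poly rat}) :
  0 <= b -> integralOver (intr : int -> R) b -> minimal_polynomial b p ->
  (forall z : C, root (map_poly ratr p) z -> normc z <= b) -> perron_value b.
Proof.
rewrite le_eqVlt => /orP[/eqP<- _ _ _|b0 bi bp]; first exact: (perron_value_nat R 0).
have [q qm pE] := minimal_polynomial_int bp bi; subst p => pb.
have [rs rsU qE] := minimal_polynomial_split qm bp.
have rsb : {in rs, forall r, normc r <= b}.
  by move=> r; rewrite -root_prod_XsubC -qE -map_ratr_int; apply: pb.
have [N circN] := circle_root_of_unity b0 bp qE rsU rsb.
apply: (@perron_value_root _ b N); first exact: ltW.
set c := b ^+ N.+1; have c0 : 0 < c by rewrite exprn_gt0.
(* The eigenvalues of this integer matrix are the powers r^(N+1) of conjugates r of b, so every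
   conjugate of c is such a power. *)
pose A := companionmx q ^+ N.+1.
have AE : map_mx intr A = map_mx intr (companionmx q) ^+ N.+1 :> 'M[C]__.
  by rewrite /A; elim: (N.+1) => [|m IHm]; rewrite ?expr0 ?map_mx1 // !exprS -!mulmxE map_mxM IHm.
have Aroot z : root (map_poly intr (char_poly A)) z ->
    exists2 r, r \in rs & z = r ^+ N.+1.
  rewrite -eigenvalue_int AE => /eigenvalue_exp[r].
  rewrite eigenvalue_int companionmxK // => qr ->; exists r => //.
  by rewrite -root_prod_XsubC -qE.
have Ac : root (map_poly intr (char_poly A)) c.
  rewrite -root_realc -eigenvalue_int AE rmorphXn eigenvalue_expr //.
  rewrite eigenvalue_int companionmxK // root_realc.
  by case: bp => _ + _; rewrite map_ratr_int.
have ci : integralOver (intr : int -> R) c.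
  by exists (char_poly A) => //; exact: char_poly_monic.
have [p' cp'] := minimal_polynomial_ex ci.
have [q' q'm p'E] := minimal_polynomial_int cp' ci; subst p'.
have [rs' rs'U q'E] := minimal_polynomial_split q'm cp'.
apply: (perron_value_strict c0 q'm q'E rs'U) => [|z].
  rewrite -root_prod_XsubC -q'E root_realc.
  by case: cp' => _ + _; rewrite map_ratr_int.
rewrite -root_prod_XsubC -q'E -map_ratr_int.
rewrite -map_ratr_int in Ac.
move=> /(minimal_polynomial_root cp' Ac); rewrite map_ratr_int => /Aroot[r rrs ->].
rewrite rmorphXn normcX lt_neqAle => rc; apply/andP; split.
  (* A conjugate r of modulus b has r^(N+1) = c, so strictness holds away from c. *)
  apply: contraNneq rc => /eqP.
  by rewrite eqrXn2 ?normc_ge0 ?(ltW b0) // => /eqP rb; rewrite circN.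
by rewrite lerXn2r ?nnegrE ?normc_ge0 ?rsb // ltW.
Qed.

End DominantIntegers.

Local Open Scope classical_set_scope.
Local Open Scope ring_scope.

(** * From Perron values to quivers *)

Section QuiverRadius.
Variable R : realType.
Import ComplexField.Normc.

(* Weighting a left eigenvector by the positive right eigenvector v bounds every eigenvalue. *)
Lemma left_eigenvalue_le n (A : 'M[int]_n) (v : 'I_n -> R) (b : R) (z : R[i]) :
  (forall i j, 0 <= A i j) -> (forall i, 0 < v i) ->
  (forall i, b * v i = \sum_j (A i j)%:~R * v j) ->
  eigenvalue (map_mx intr A) z -> normc z <= b.
Proof.
move=> A0 v0 Av /eigenvalueP[w wA w0].
have /rV0Pn[k wk] := w0.
have s0 : 0 < \sum_j normc (w 0 j) * v j.
  rewrite (bigD1 k) //= ltr_pwDl ?mulr_gt0 ?normc_gt0 //.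
  by apply: sumr_ge0 => j _; rewrite mulr_ge0 ?normc_ge0 // ltW.
rewrite -(ler_pM2r s0) !mulr_sumr.
apply: (@le_trans _ _ (\sum_j (\sum_i normc (w 0 i) * (A i j)%:~R) * v j)).
  apply: ler_sum => j _; rewrite mulrA ler_pM2r // -normcM.
  have := congr1 (fun M : 'rV_n => M 0 j) wA; rewrite !mxE => <-.
  apply: le_trans (le_normc_sum _ _ _) _; apply: ler_sum => i _.
  by rewrite normcM mxE normc_int ger0_norm // ler0z.
under eq_bigr do rewrite mulr_suml.
rewrite exchange_big /=; apply: ler_sum => i _.
by rewrite mulrCA Av mulr_sumr; apply: ler_sum => j _; rewrite mulrA.
Qed.

Lemma spectral_radius_max n (A : 'M[int]_n) (la : R[i]) :
  eigenvalue (map_mx intr A) la ->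
  (forall z, eigenvalue (map_mx intr A) z -> normc z <= normc la) ->
  spectral_radius R A = normc la.
Proof.
move=> Ala Amax; apply/eqP; rewrite eq_le; apply/andP; split.
  by apply: ge_sup; [exists (normc la), la | move=> _ [z zA <-]; apply: Amax].
by apply: ub_le_sup; [exists (normc la) => _ [z zA <-]; apply: Amax | exists la].
Qed.

Lemma spectral_radius_attained n (A : 'M[int]_n) : (0 < n)%N ->
  exists2 la : R[i], eigenvalue (map_mx intr A) la &
    forall z, eigenvalue (map_mx intr A) z -> normc z <= normc la.
Proof.
move=> n0; have [z0 Az0] := eigenvalue_ex (map_mx intr A : 'M[R[i]]_n) n0.
have [rs AE] := closed_field_poly_normal (char_poly (map_mx intr A : 'M[R[i]]_n)).
have Ars z : eigenvalue (map_mx intr A) z = (z \in rs).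
  rewrite eigenvalue_root_char AE (monicP (char_poly_monic _)) scale1r.
  exact: root_prod_XsubC.
rewrite Ars in Az0.
have [la lars lamax] : exists2 la, la \in rs & {in rs, forall z, normc z <= normc la}.
  elim: rs z0 Az0 {AE Ars} => // r rs IHrs _ _.
  case: rs IHrs => [_|s rs IHrs].
    by exists r; rewrite ?mem_head // => z; rewrite inE => /eqP->.
  have [t ts tmax] := IHrs s (mem_head _ _).
  case: (lerP (normc t) (normc r)) => tr.
    exists r; first exact: mem_head.
    by move=> z; rewrite inE => /orP[/eqP->//|/tmax/le_trans]; apply.
  exists t; first by rewrite inE ts orbT.
  by move=> z; rewrite inE => /orP[/eqP->|/tmax//]; apply: ltW.
by exists la; rewrite ?Ars // => z; rewrite Ars; apply: lamax.
Qed.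

Lemma spectral_radius_perron n (A : 'M[int]_n) (v : 'I_n -> R) (b : R) :
  (0 < n)%N -> (forall i j, 0 <= A i j) -> (forall i, 0 < v i) ->
  (forall i, b * v i = \sum_j (A i j)%:~R * v j) ->
  spectral_radius R A = b.
Proof.
move=> n0 A0 v0 Av; have i0 := Ordinal n0.
have b0 : 0 <= b.
  rewrite -(pmulr_lge0 _ (v0 i0)) Av sumr_ge0 // => j _.
  by rewrite mulr_ge0 ?ler0z // ltW.
have eb : eigenvalue (map_mx intr A) (real_complex R b).
  (* [eigenvalue] refers to row vectors, whereas v is a column eigenvector. *)
  rewrite -eigenvalue_trmx.
  apply/eigenvalueP; exists (\row_j real_complex R (v j)).
    apply/rowP => j; rewrite !mxE -rmorphM Av rmorph_sum.
    by apply: eq_bigr => k _; rewrite !mxE rmorphM rmorph_int mulrC.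
  apply/rV0Pn; exists i0; rewrite mxE -normc_eq0 normc_realc.
  by rewrite normr_eq0 gt_eqF.
have nb : normc (real_complex R b) = b by rewrite normc_realc ger0_norm.
rewrite (spectral_radius_max eb) ?nb // => z zA.
exact: left_eigenvalue_le zA.
Qed.

Lemma perron_value_quiver (b : R) : perron_value b -> quiver_radius b.
Proof.
move=> /perron_value_connect[T [v [a [T0 v0 av aT]]]].
(* An arrow is a pair of vertices tagged with an index below the matrix entry, which gives exactly
   [a x y] arrows from x to y. *)
pose E := {t : T * T & 'I_(a t.1 t.2)}.
pose Q := @FiniteQuiver T E (fun e => (tag e).1) (fun e => (tag e).2).
have aE (x y : vertex Q) : num_arrows x y = a x y.
  pose f (i : 'I_(a x y)) : E := Tagged (fun t => 'I_(a t.1 t.2)) (i : 'I_(a (x, y).1 (x, y).2)).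
  have f_inj : injective f by move=> i j /eqP; rewrite eq_Tagged => /eqP.
  rewrite -[RHS]card_ord -(card_codom f_inj); apply: eq_card => -[[x' y'] i].
  rewrite inE /=; apply/andP/codomP => [[/eqP/= xx' /eqP/= yy']|[j /(congr1 tag)/= [-> ->]]//].
  by subst x' y'; exists i.
exists Q; first split=> // x y.
  apply: connect_sub (aT x y) => {}x {}y /= axy; apply/connect1/existsP.
  have [e] : exists e, e \in [pred e : arrow Q | (source e == x :> vertex Q) && (target e == y)].
    by apply/card_gt0P; rewrite -/(@num_arrows Q x y) aE.
  by exists e.
apply: (@spectral_radius_perron _ _ (fun i => v (enum_val i))) => // i.
- by move=> j; rewrite mxE.
- rewrite av (reindex (@enum_val T T)) /=; last exact/onW_bij/enum_val_bij.
  by apply: eq_bigr => j _; rewrite mxE aE.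
Qed.

End QuiverRadius.

(** * The equivalence, closure under roots, and density *)

Section Radii.
Variable R : realType.
Implicit Types b : R.
Import ComplexField.Normc.

Lemma quiver_radius_matrix b : quiver_radius b -> integer_matrix_radius b.
Proof. by move=> [Q [Q0 _] Qb]; exists #|vertex Q|, (adjacency_mx Q). Qed.

Lemma matrix_radius_dominant b :
  integer_matrix_radius b -> dominant_algebraic_integer b.
Proof.
move=> [n [A [n0 <-]]]; have [la Ala Amax] := spectral_radius_attained R A n0.
rewrite (spectral_radius_max Ala Amax).
by have [bi bp] := dominant_eigenvalue_conjugates Ala Amax; split=> //; exact: normc_ge0.
Qed.

Lemma dominant_perron b : dominant_algebraic_integer b -> perron_value b.
Proof. by move=> [b0 bi [p bp pb]]; apply: dominant_perron_value bp pb. Qed.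

(** The closure properties and the gap below 1 pass from Perron values to [radii] through this
    equivalence. *)
Lemma radiiP b : radii R b <-> perron_value b.
Proof.
split=> [[_ _ /dominant_perron//]|/perron_value_quiver bq].
have bm := quiver_radius_matrix bq.
by split=> //; apply: matrix_radius_dominant.
Qed.

Lemma powR_rootK b m : (0 < m)%N -> 0 <= b -> (b `^ (m%:R^-1)) ^+ m = b.
Proof.
move=> m0 b0; rewrite -powR_mulrn ?powR_ge0 // -powRrM mulVf ?powRr1 //.
by rewrite pnatr_eq0 -lt0n.
Qed.

Lemma perron_value_powR_root b m : (0 < m)%N -> 0 <= b ->
  perron_value b -> perron_value (b `^ (m%:R^-1)).
Proof.
move=> m0 b0 bP; apply: (@perron_value_root _ _ m.-1); first exact: powR_ge0.
by rewrite prednK // powR_rootK.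
Qed.

Lemma exprB_ge (x y : R) m : 1 <= y -> y <= x ->
  m%:R * (x - y) <= x ^+ m - y ^+ m.
Proof.
move=> y1 yx; have xy0 : 0 <= x - y by rewrite subr_ge0.
elim: m => [|m IHm]; first by rewrite mul0r !expr0 subrr.
have -> : x ^+ m.+1 - y ^+ m.+1 = x * (x ^+ m - y ^+ m) + y ^+ m * (x - y).
  by rewrite !exprS; ring.
rewrite -addn1 natrD mulrDl mul1r lerD //.
  apply: (le_trans IHm); rewrite ler_peMl ?(le_trans y1) //.
  by apply: le_trans IHm; rewrite mulr_ge0.
by rewrite ler_peMl // exprn_ege1.
Qed.

(** The m-th roots of positive integers approximate x: with n the integer part of x^m and y^m = n, m
    (x - y) <= x^m - n < 1 < m e by [exprB_ge]. *)
Lemma radii_dense (x : R) : 1 <= x -> closure (radii R) x.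
Proof.
move=> x1 U /nbhs_ballP[e /= e0 xU].
have x0 : 0 <= x by apply: le_trans x1.
have [m m0 me] : exists2 m, (0 < m)%N & 1 < m%:R * e.
  have e1 : 0 <= e^-1 by rewrite invr_ge0 ltW.
  exists (Num.bound e^-1).
    by rewrite -(ltr_nat R) (le_lt_trans e1) // archi_boundP.
  by rewrite -ltr_pdivrMr // div1r archi_boundP.
have xm1 : 1 <= x ^+ m by rewrite exprn_ege1.
have /andP[nx xn] := truncn_itv (le_trans ler01 xm1).
set n := Num.truncn _ in nx xn.
have n0 : (0 < n)%N by rewrite lt0n; apply: contraTneq xn => ->; rewrite -leNgt.
pose y := n%:R `^ (m%:R^-1) : R.
have yn : y ^+ m = n%:R by rewrite powR_rootK.
have yP : perron_value y by apply: perron_value_powR_root => //; exact: perron_value_nat.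
have y0 : 0 <= y by exact: powR_ge0.
have y1 : 1 <= y.
  case: (perron_value_eq0_or_ge1 yP) => // y00.
  by move: yn; rewrite y00 expr0n gtn_eqF // => /esym/eqP; rewrite pnatr_eq0 gtn_eqF.
have yx : y <= x by rewrite -(ler_pXn2r m0) ?nnegrE // yn.
exists y; split; first exact/radiiP.
apply: xU; rewrite /ball /= ger0_norm ?subr_ge0 //.
rewrite -(ltr_pM2l (x := m%:R)) ?ltr0n //; apply: le_lt_trans (exprB_ge m y1 yx) _.
rewrite yn; apply: lt_trans me.
by rewrite ltrBlDl natr1.
Qed.

End Radii.

Theorem proposition3p8 (R : realType) :
  (forall b : R,
     [<-> quiver_radius b;
          integer_matrix_radius b;
          dominant_algebraic_integer b]) /\
  (forall a b : R, radii R a -> radii R b -> radii R (a + b)) /\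
  (forall a b : R, radii R a -> radii R b -> radii R (a * b)) /\
  (forall (b : R) (m : nat), (0 < m)%N -> radii R b ->
     radii R (b `^ (m%:R^-1))) /\
  radii R `<=` [set 0] `|` `[1, +oo[ /\
  [set 0] `|` `[1, +oo[ `<=` closure (radii R).
Proof.
split; [|split; [|split; [|split; [|split]]]].
- move=> b; tfae; [exact: quiver_radius_matrix|exact: matrix_radius_dominant|].
  by move=> /dominant_perron; exact: perron_value_quiver.
- by move=> a b /radiiP aP /radiiP bP; apply/radiiP; exact: perron_valueD.
- by move=> a b /radiiP aP /radiiP bP; apply/radiiP; exact: perron_valueM.
- move=> b m m0 bR; apply/radiiP; apply: perron_value_powR_root => //.
    by case: bR => _ _ [].
  exact/radiiP.
- move=> b /radiiP/perron_value_eq0_or_ge1[->|b1]; [by left | right].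
  by rewrite /= in_itv /= andbT.
- move=> x [->|/=].
    by apply: subset_closure; apply/radiiP; exact: (perron_value_nat R 0).
  by rewrite in_itv /= andbT => /radii_dense.
Qed.
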